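(* Suppose there exists a sequence of lists $L^{(i)}$ such that \[ \lim_{i\to\infty}\frac{\mathbb{E}_\sigma[\mathrm{DNF}(\sigma(L^{(i)}))]}{\mathrm{OPT}(L^{(i)})}=\mathrm{ROR}(\mathrm{DNF}) \] and $s(L^{(i)})/N(L^{(i)})^{2/3}\to\infty$ as $i\to\infty$. Then $\mathrm{ROR}(\mathrm{DNF})=\overline{\mathrm{AECR}}(\mathrm{DNF})$.
   Context: Bin covering: a list $L=(a_1,\ldots,a_N)$ of item sizes in $[0,1]$; $N(L)=N$ and $s(L)=\sum_i a_i$. A bin is covered if its total size is at least $1$. $\mathrm{OPT}(L)$ is the maximum number of pairwise disjoint sets of items of $L$ each of total size at least $1$. Dual Next-Fit ($\mathrm{DNF}$) processes the items in order, putting every item into a single current bin; as soon as the current bin has total size at least $1$ it is counted as covered and a new empty current bin is started; $\mathrm{DNF}(L)$ is the number of covered bins. $\sigma(L)$ denotes $L$ permuted by a uniformly random permutation $\sigma$ of its positions. A discrete distribution $F$ is given by non-negative rational item sizes and positive rational probabilities summing to $1$; $I_n(F)$ is a list of $n$ i.i.d. items drawn from $F$. $\overline{\mathrm{AECR}}(\mathrm{DNF})=\inf_F\liminf_{n\to\infty}\mathbb{E}[\mathrm{DNF}(I_n(F))]/\mathbb{E}[\mathrm{OPT}(I_n(F))]$, infimum over all discrete distributions. $\mathrm{ROR}(\mathrm{DNF})=\liminf_{\mathrm{OPT}(L)\to\infty}\mathbb{E}_\sigma[\mathrm{DNF}(\sigma(L))]/\mathrm{OPT}(L)$ (i.e.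 $\lim_{k\to\infty}\inf_{L:\,\mathrm{OPT}(L)\ge k}$). *)

(* Defs.v *)
From HB Require Import structures.
From mathcomp Require Import all_boot all_order all_algebra all_fingroup.
From mathcomp Require Import all_classical all_reals all_analysis.
Set Implicit Arguments.
Unset Strict Implicit.
Unset Printing Implicit Defensive.
Import Order.TTheory GRing.Theory Num.Theory.
Import numFieldNormedType.Exports.
Local Open Scope classical_set_scope.
Local Open Scope ring_scope.

Section BinCovering.
Variable R : realType.
Implicit Types L : seq R.

Definition is_item_list L : bool := all (fun a => 0 <= a <= 1) L.

Definition total_size L : R := \sum_(a <- L) a.

(* Bins are sets of positions of L, so equal-sized items are distinct items.
   An empty set has total size 0, hence is never a covered bin. *)
Definition is_covering L (P : {set {set 'I_(size L)}}) : bool :=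
  finset.trivIset P && [forall B in P, 1 <= \sum_(i in B) L`_i].

Definition OPT L : nat :=
  (\max_(P : {set {set 'I_(size L)}} | is_covering P) #|P|)%N.

(* [load] is the total size of the current, not yet covered, bin. *)
Fixpoint DNF_from (load : R) L : nat :=
  if L is a :: L' then
    if 1 <= load + a then (DNF_from 0 L').+1 else DNF_from (load + a) L'
  else 0%N.

Definition DNF L : nat := DNF_from 0 L.

Definition permuted L (s : 'S_(size L)) : seq R :=
  [seq L`_(s i) | i : 'I_(size L)].

Definition expect_perm (f : seq R -> R) L : R :=
  (\sum_(s : 'S_(size L)) f (permuted s)) / #|{: 'S_(size L)}|%:R.

Definition random_order_ratio L : R :=
  expect_perm (fun L' => (DNF L')%:R) L / (OPT L)%:R.

Definition ROR_DNF : \bar R :=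
  limn (fun k : nat =>
    ereal_inf [set (random_order_ratio L)%:E |
                 L in [set L | is_item_list L /\ (k <= OPT L)%N]]).

End BinCovering.

Record discrete_distribution : Type := DiscreteDistribution {
  atoms : nat;
  item_size : 'I_atoms -> rat;
  item_prob : 'I_atoms -> rat;
  item_size_itv : forall j, 0 <= item_size j <= 1;
  item_prob_gt0 : forall j, 0 < item_prob j;
  item_prob_sum : \sum_j item_prob j = 1
}.

Section AverageCase.
Variable R : realType.
Implicit Type F : discrete_distribution.

(* The expectation of f (I_n(F)): the outcome w (the atom drawn at each
   position) has the product probability, by independence. *)
Definition expect_iid F (n : nat) (f : seq R -> R) : R :=
  \sum_(w : {ffun 'I_n -> 'I_(atoms F)})
    (\prod_(i < n) ratr (item_prob (w i))) *
    f [seq ratr (item_size (w i)) | i : 'I_n].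

Definition average_case_ratio F (n : nat) : R :=
  expect_iid F n (fun L => (DNF L)%:R) / expect_iid F n (fun L => (OPT L)%:R).

(* For the distribution concentrated at size 0, OPT vanishes identically and
   the ratio is 0/0 for every n, so it is excluded. For any other F the
   denominator is positive for all large n. *)
Definition nondegenerate F : Prop := exists j : 'I_(atoms F), 0 < item_size j.

Definition AECR_DNF : \bar R :=
  ereal_inf [set limn_einf (fun n : nat => (average_case_ratio F n)%:E) |
               F in [set F | nondegenerate F]].

End AverageCase.

(* Main.v *)
Require Import Defs.
From HB Require Import structures.
From mathcomp Require Import all_boot all_order all_algebra all_fingroup.
From mathcomp Require Import all_classical all_reals all_analysis.
From mathcomp Require Import ring lra.
Set Implicit Arguments.
Unset Strict Implicit.
Unset Printing Implicit Defensive.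
Import Order.TTheory GRing.Theory Num.Theory.
Import numFieldNormedType.Exports.
Local Open Scope classical_set_scope.
Local Open Scope ring_scope.

(* ROR <= AECR: an i.i.d. list is exchangeable, so E[DNF(I_n)] averages
   E_sigma[DNF(sigma(L))], which is at least r OPT(L) as soon as OPT(L) >= k,
   where r is the infimum of the random-order ratios over such L; moreover
   E[OPT(I_n)] grows linearly.

   AECR <= ROR: given L with N items, round the sizes up to rationals without
   changing which subsets cover a bin, and let F be uniform on the items.
   Concatenating blocks changes DNF by at most one per block, so both
   E[DNF(I_n(F))] and E_sigma[DNF(sigma(L))] are governed by the expected DNF of
   K random items, drawn with resp. without replacement. These two expectations
   differ by at most K * P(collision) <= K^3 / N. By the variance of the item
   counts, E[OPT(I_n(F))] is at least (n / N) OPT(L) (1 - o(1)). Taking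
   K ~ N^(1/3), all the relative errors are O(N^(2/3) / s(L)). *)

(** * Coverings as labellings, and deterministic bounds on [OPT] and [DNF] *)

Section Packing.
Variable R : realType.
Implicit Types L : seq R.

(* A packing is a labelling of the items by bin numbers; items with a label
   [>= k] are unused. *)
Definition coverable (k : nat) L : Prop :=
  exists2 p : seq (R * nat), perm_eq (map fst p) L &
    forall b, (b < k)%N -> 1 <= \sum_(x <- p | x.2 == b) x.1.

Lemma map_nth_enum L : map (fun i : 'I_(size L) => L`_i) (enum 'I_(size L)) = L.
Proof.
rewrite -[RHS](take_size L) -(@map_nth_iota0 _ 0 L (size L)) //.
by rewrite -[in RHS]val_enum_ord -map_comp.
Qed.

(** An equality with [L], stronger than [perm_eq], lets [leq_OPT_map] carry the labels along item by
    item. *)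
Lemma OPT_labelling L : exists2 p : seq (R * nat), map fst p = L &
  forall b, (b < OPT L)%N -> 1 <= \sum_(x <- p | x.2 == b) x.1.
Proof.
rewrite /OPT; have [P covP ->] : {P : {set {set 'I_(size L)}} | is_covering P
    & \max_(P : {set {set 'I_(size L)}} | is_covering P) #|P| = #|P|}%N.
  apply: eq_bigmax_cond; apply/card_gt0P; exists finset.set0.
  rewrite unfold_in /is_covering; apply/andP; split.
    by apply/finset.trivIsetP => A B; rewrite finset.inE.
  by apply/forall_inP => B; rewrite finset.inE.
have /andP[tP /forall_inP sP] := covP.
(* Items in no bin of [P] get the out-of-range label [#|P|]. *)
pose g i := if i \in finset.cover P then index (finset.pblock P i) (enum P) else #|P|.
exists [seq (L`_i, g i) | i : 'I_(size L)].
  by rewrite -map_comp -[RHS]map_nth_enum; apply: eq_map.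
move=> b bP; rewrite big_image_cond /=.
have sB : nth finset.set0 (enum P) b \in P.
  by rewrite -mem_enum mem_nth // -cardE.
apply: (le_trans (sP _ sB)); rewrite le_eqVlt; apply/orP; left; apply/eqP.
apply: eq_bigl => i /=; rewrite /g; apply/idP/idP => [iB|].
  have -> : i \in finset.cover P by apply/finset.bigcupP; exists (nth finset.set0 (enum P) b).
  by rewrite (finset.def_pblock tP sB iB) index_uniq ?enum_uniq // -cardE.
case: ifP => [iC /eqP gb|_ /eqP gb]; last by rewrite gb ltnn in bP.
by rewrite -gb nth_index ?mem_enum ?finset.pblock_mem // finset.mem_pblock.
Qed.

Lemma coverable_OPT L : coverable (OPT L) L.
Proof. by have [p <- pb] := OPT_labelling L; exists p. Qed.

Lemma coverable_leq_OPT k L : coverable k L -> (k <= OPT L)%N.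
Proof.
case=> p; rewrite perm_sym => /(perm_iotaP 0)[Is pI eL] sp.
rewrite size_map in pI.
pose g (i : 'I_(size L)) := (nth (0, 0%N) p (nth 0%N Is i)).2.
have sg b : \sum_(i | g i == b) L`_i = \sum_(x <- p | x.2 == b) x.1.
  have sI : size Is = size L by rewrite eL size_map.
  rewrite [RHS](big_nth (0, 0%N)) /index_iota subn0 -(perm_big _ pI) /=.
  rewrite (big_nth 0%N) big_mkord sI; apply: eq_bigr => i _.
  have iI : (i < size Is)%N by rewrite sI.
  move: (nat_of_ord i) iI => m iI; rewrite [in LHS]eL (nth_map 0%N) //.
  have : nth 0%N Is m \in iota 0 (size p) by rewrite -(perm_mem pI) mem_nth.
  by rewrite mem_iota => lt; rewrite (nth_map (0, 0%N)).
pose B (b : 'I_k) := [set i | g i == b]%SET.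
have B1 b : 1 <= \sum_(i in B b) L`_i.
  by under eq_bigl do rewrite finset.inE; rewrite sg sp.
(* A bin of total size at least 1 is nonempty, and any of its items determines its label; hence the
   [k] bins are distinct sets. *)
have Binj : injective B.
  move=> b c ebc; have : B b != finset.set0.
    apply/negP => /eqP b0; have := B1 b.
    by rewrite b0 finset.big_set0 ler10.
  move=> /finset.set0Pn[i ib]; have := ib; rewrite {1}ebc !finset.inE => /eqP ic.
  by move: ib; rewrite finset.inE => /eqP ib; apply/val_inj; rewrite /= -ib.
have <- : #|(B @: 'I_k)%SET| = k by rewrite finset.card_imset // card_ord.
rewrite /OPT; apply: (@leq_bigmax_cond _ _ _ (B @: 'I_k)%SET); rewrite /is_covering.
apply/andP; split.
  apply/finset.trivIsetP => _ _ /finset.imsetP[b _ ->] /finset.imsetP[c _ ->] ne.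
  rewrite -finset.setI_eq0; apply/eqP/finset.setP => i; rewrite !finset.inE.
  apply/negP => /andP[/eqP ib /eqP ic]; move/eqP: ne; apply.
  by congr B; apply/val_inj; rewrite /= -ib.
by apply/forall_inP => _ /finset.imsetP[b _ ->].
Qed.

Lemma coverable_perm k L1 L2 : perm_eq L1 L2 -> coverable k L1 -> coverable k L2.
Proof. by move=> e [p p1 pb]; exists p => //; apply: perm_trans e. Qed.

Lemma leq_OPT_perm L1 L2 : perm_eq L1 L2 -> (OPT L1 <= OPT L2)%N.
Proof. by move=> e; apply/coverable_leq_OPT/(coverable_perm e)/coverable_OPT. Qed.

Lemma OPT_cat L1 L2 : is_item_list L1 -> is_item_list L2 ->
  (OPT L1 + OPT L2 <= OPT (L1 ++ L2))%N.
Proof.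
move=> i1 i2; have [p p1 pb] := coverable_OPT L1; have [q q1 qb] := coverable_OPT L2.
apply: coverable_leq_OPT.
have ge0 (r : seq (R * nat)) L : perm_eq (map fst r) L -> is_item_list L ->
    forall h : R * nat -> bool, 0 <= \sum_(x <- r | h x) x.1.
  move=> e /allP iL h; rewrite big_seq_cond; apply: sumr_ge0 => x /andP[xr _].
  by have /iL/andP[] : x.1 \in L by rewrite -(perm_mem e) map_f.
exists (p ++ [seq (x.1, (x.2 + OPT L1)%N) | x <- q]).
  by rewrite map_cat -map_comp; apply: perm_cat.
move=> b bk; rewrite big_cat /=; have [b1|b1] := ltnP b (OPT L1).
  rewrite -[1]addr0 lerD ?pb //.
  by rewrite big_map; apply: ge0 q1 i2 _.
rewrite -[1]add0r lerD //; first exact: ge0 p1 i1 _.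
rewrite big_map /=; have := qb (b - OPT L1)%N; rewrite ltn_subLR // => /(_ bk) /le_trans; apply.
rewrite le_eqVlt; apply/orP; left; apply/eqP; apply: eq_bigl => x.
by rewrite -(eqn_add2r (OPT L1)) subnK.
Qed.

Lemma leq_OPT_map (T : Type) (f g : T -> R) (s : seq T) :
  (forall x, f x <= g x) -> (OPT (map f s) <= OPT (map g s))%N.
Proof.
move=> fg; have [p p1 pb] := OPT_labelling (map f s); apply: coverable_leq_OPT.
have [q q1 qb] : exists2 q : seq (R * nat), map fst q = map g s &
    forall b, \sum_(x <- p | x.2 == b) x.1 <= \sum_(x <- q | x.2 == b) x.1.
  elim: s p p1 {pb} => [|a s IH] [|[x c] p] //=.
    by move=> _; exists [::] => // b; rewrite !big_nil.
  case=> -> /IH[q q1 qb]; exists ((g a, c) :: q); first by rewrite /= q1.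
  by move=> b; rewrite !big_cons /=; case: ifP => _; rewrite ?lerD.
by exists q => [|b bk]; rewrite ?q1 // (le_trans (pb _ bk)).
Qed.

Lemma coverable_DNF L : coverable (DNF L) L.
Proof.
(* The induction needs an arbitrary initial load [x], credited to bin 0, the one being filled. *)
suff : forall x : R, exists2 p : seq (R * nat), map fst p = L &
    forall b, (b < DNF_from x L)%N ->
      1 <= (if b == 0%N then x else 0) + \sum_(y <- p | y.2 == b) y.1.
  move=> /(_ 0)[p pL pb]; exists p => [|b /pb]; first by rewrite pL.
  by rewrite if_same add0r.
elim: L => [|a L IH] x /=; first by exists [::].
case: ifP => xa.
  have [p pL pb] := IH 0; exists ((a, 0%N) :: [seq (y.1, y.2.+1) | y <- p]).
    by rewrite /= -map_comp -[in RHS]pL.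
  move=> [|b] bD; rewrite big_cons big_map /=; first by rewrite big_pred0_eq addr0.
  by have := pb _ bD; rewrite if_same.
have [p pL pb] := IH (x + a); exists ((a, 0%N) :: p); first by rewrite /= pL.
by move=> [|b] /pb; rewrite big_cons //= addrA.
Qed.

Lemma DNF_leq_OPT L : (DNF L <= OPT L)%N.
Proof. exact/coverable_leq_OPT/coverable_DNF. Qed.

Lemma DNF_from_size (x : R) L : (DNF_from x L <= size L)%N.
Proof.
elim: L x => //= a L IH x; case: ifP => _; first by rewrite ltnS IH.
exact: leqW (IH _).
Qed.

(** A load below 1 plus an item of size at most 1 closes a bin below 2, and the last open bin holds
    less than 1. *)
Lemma total_size_DNF L : is_item_list L -> total_size L <= 2 * (DNF L)%:R + 1.
Proof.
move=> iL; suff /(_ 0) : forall x, x < 1 -> x + total_size L <= 2 * (DNF_from x L)%:R + 1.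
  by rewrite add0r; apply; rewrite ltr01.
rewrite /total_size; elim: L iL => [|a L IH] /=.
  by move=> _ x x1; rewrite big_nil; lra.
move=> /andP[/andP[a0 a1] /IH{}IH] x x1; rewrite big_cons; case: ifP => [_|/negbT].
  by have := IH 0 ltr01; rewrite -natr1; lra.
by rewrite -ltNge => /IH; lra.
Qed.

Lemma total_size_OPT L : is_item_list L -> total_size L <= 2 * (OPT L)%:R + 1.
Proof.
move=> iL; apply: (le_trans (total_size_DNF iL)).
by rewrite lerD2r ler_pM2l // ler_nat DNF_leq_OPT.
Qed.

(** When the run with the larger load closes a bin alone, it restarts from 0 and the other run now
    has the larger load. The roles swap, so the lead never exceeds one bin. *)
Lemma DNF_from_load (x y : R) L : is_item_list L -> 0 <= y <= x ->
  (DNF_from y L <= DNF_from x L <= (DNF_from y L).+1)%N.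
Proof.
elim: L x y => [|a L IH] x y //= /andP[/andP[a0 a1] /[dup] iL /IH{}IH].
case/andP => y0 yx; case: ifP => ya; case: ifP => xa.
- by rewrite leqnn leqnSn.
- by move/negbT: xa; rewrite -ltNge; lra.
- have /andP[h1 h2] : (DNF_from 0 L <= DNF_from (y + a) L <= (DNF_from 0 L).+1)%N.
    by apply: IH; rewrite lexx addr_ge0.
  by rewrite h2 ltnS h1.
- by apply: IH; rewrite addr_ge0 // lerD2r.
Qed.

Lemma DNF_from_cat (x : R) L1 L2 : 0 <= x -> is_item_list L1 -> is_item_list L2 ->
  (DNF_from x L1 + DNF L2 <= DNF_from x (L1 ++ L2) <= DNF_from x L1 + (DNF L2).+1)%N.
Proof.
move=> + + i2; elim: L1 x => [|a L1 IH] x x0 /=.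
  by move=> _; rewrite !add0n; apply: DNF_from_load; rewrite ?lexx.
move=> /andP[/andP[a0 a1] iL]; case: ifP => _; first by rewrite !addSn !ltnS IH.
by apply: IH => //; rewrite addr_ge0.
Qed.

Lemma DNF_cat L1 L2 : is_item_list L1 -> is_item_list L2 ->
  (DNF L1 + DNF L2 <= DNF (L1 ++ L2) <= DNF L1 + (DNF L2).+1)%N.
Proof. by move=> i1 i2; apply: DNF_from_cat. Qed.

(** [DNF] sees the sizes only through the test whether the content of the current bin reaches 1. *)
Lemma DNF_eq_map (T : eqType) (f g : T -> R) (t : seq T) : uniq t ->
  (forall u, uniq u -> (1 <= \sum_(i <- u) f i) = (1 <= \sum_(i <- u) g i)) ->
  DNF (map f t) = DNF (map g t).
Proof.
move=> ut fg; suff /(_ [::]) : forall u, uniq (u ++ t) ->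
    DNF_from (\sum_(i <- u) f i) (map f t) = DNF_from (\sum_(i <- u) g i) (map g t).
  by rewrite !big_nil; apply.
elim: t {ut} => //= a t IH u ut.
have ut' : uniq (rcons u a ++ t) by rewrite cat_rcons.
have ua : uniq (rcons u a) by move: ut'; rewrite cat_uniq => /and3P[].
have := IH _ ut'; have := fg _ ua; rewrite -!cats1 !big_cat /= !big_seq1 => <- ->.
case: ifP => // _; congr S; have := IH [::]; rewrite !big_nil; apply.
by move: ut'; rewrite cat_uniq => /and3P[].
Qed.

End Packing.

(** * Expectations over independent draws from a finite set *)

Section IidMean.
Variables (R : realType) (T : finType) (p : T -> R).
Hypotheses (p_ge0 : forall j, 0 <= p j) (p_sum : \sum_j p j = 1).
Implicit Types (f g : seq T -> R) (n : nat).

(** Recursion on the first draw turns linearity, concatenation and the variance into plain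
    inductions; [sum_ffun_iid_mean] identifies the result with the sum against the product law. *)
Fixpoint iid_mean n f : R :=
  if n is n'.+1 then \sum_j p j * iid_mean n' (fun s => f (j :: s)) else f [::].

Lemma ler_iid_mean n f g :
  (forall s, size s = n -> f s <= g s) -> iid_mean n f <= iid_mean n g.
Proof.
elim: n f g => [|n IH] f g fg /=; first exact: fg.
by apply: ler_sum => j _; rewrite ler_wpM2l // IH // => s sn; rewrite fg //= sn.
Qed.

Lemma eq_iid_mean n f g :
  (forall s, size s = n -> f s = g s) -> iid_mean n f = iid_mean n g.
Proof.
elim: n f g => [|n IH] f g fg /=; first exact: fg.
by apply: eq_bigr => j _; congr (_ * _); apply: IH => s sn; rewrite fg //= sn.
Qed.

Lemma iid_mean_cst n c : iid_mean n (fun=> c) = c.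
Proof.
elim: n => //= n IH; rewrite -[RHS]mul1r -p_sum mulr_suml.
by apply: eq_bigr => j _; rewrite IH.
Qed.

Lemma iid_meanD n f g : iid_mean n (fun s => f s + g s) = iid_mean n f + iid_mean n g.
Proof.
elim: n f g => //= n IH f g; rewrite -big_split /=; apply: eq_bigr => j _.
by rewrite IH mulrDr.
Qed.

Lemma iid_meanZ n c f : iid_mean n (fun s => c * f s) = c * iid_mean n f.
Proof.
elim: n f => //= n IH f; rewrite mulr_sumr; apply: eq_bigr => j _.
by rewrite IH mulrCA.
Qed.

Lemma iid_mean_sum (I : finType) n (F : I -> seq T -> R) :
  iid_mean n (fun s => \sum_i F i s) = \sum_i iid_mean n (F i).
Proof.
elim: n F => //= n IH F; rewrite exchange_big /=; apply: eq_bigr => j _.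
by rewrite IH mulr_sumr.
Qed.

Lemma iid_mean_cat m n f :
  iid_mean (m + n) f = iid_mean m (fun s => iid_mean n (fun t => f (s ++ t))).
Proof. by elim: m f => //= m IH f; apply: eq_bigr => j _; rewrite IH. Qed.

Lemma iid_mean_total n (a : T -> R) :
  iid_mean n (fun s => \sum_(j <- s) a j) = n%:R * \sum_j p j * a j.
Proof.
elim: n => [|n IH] /=; first by rewrite big_nil mul0r.
under eq_bigr => j _.
  rewrite (eq_iid_mean (g := fun s => a j + \sum_(i <- s) a i)); last by move=> s _; rewrite big_cons.
  rewrite iid_meanD iid_mean_cst IH mulrDr; over.
by rewrite big_split /= -mulr_suml p_sum mul1r -natr1 mulrDl mul1r addrC.
Qed.

(** The binomial variance. The offset [x] makes the induction work: a first draw [i] turns it into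
    [x + (i == j)%:R - p j], whose mean is again [x]. *)
Lemma iid_mean_count_var n (j : T) (x : R) :
  iid_mean n (fun s => (x + (count_mem j s)%:R - n%:R * p j) ^+ 2) =
  x ^+ 2 + n%:R * (p j * (1 - p j)).
Proof.
elim: n x => [|n IH] x; first by rewrite /=; ring.
transitivity (\sum_i p i * ((x + (i == j)%:R - p j) ^+ 2 + n%:R * (p j * (1 - p j)))).
  apply: eq_bigr => i _; congr (_ * _); rewrite -IH; apply: eq_iid_mean => s _.
  suff -> : x + (count_mem j (i :: s))%:R - n.+1%:R * p j =
      x + (i == j)%:R - p j + (count_mem j s)%:R - n%:R * p j :> R by [].
  have -> : (count_mem j (i :: s))%:R = (i == j)%:R + (count_mem j s)%:R :> R by rewrite /= natrD.
  by rewrite -natr1; ring.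
transitivity (\sum_i (p i * ((x - p j) ^+ 2 + n%:R * (p j * (1 - p j))) +
    (i == j)%:R * (p i * (2 * (x - p j) + 1)))).
  apply: eq_bigr => i _; set V := n%:R * _.
  suff E (b : bool) (y : R) : y * ((x + b%:R - p j) ^+ 2 + V) =
      y * ((x - p j) ^+ 2 + V) + b%:R * (y * (2 * (x - p j) + 1)) by exact: E.
  by case: b => /=; ring.
rewrite big_split /= -mulr_suml p_sum (bigD1 j) //= eqxx big1 => [|i /negbTE ->].
  by rewrite -[n.+1%:R]natr1 /=; ring.
by rewrite mul0r.
Qed.

(** Follows from the variance without square roots: [t] is free, and for [n] equal to the square of
    [t] the bound is [t]. *)
Lemma iid_mean_count_dev n (j : T) (t : R) : 0 < t ->
  iid_mean n (fun s => `|(count_mem j s)%:R - n%:R * p j|) <= (n%:R / t + t) / 2.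
Proof.
move=> t0; have t0' : 0 < t^-1 by rewrite invr_gt0.
apply: (@le_trans _ _ (iid_mean n (fun s => t^-1 / 2 *
    (0 + (count_mem j s)%:R - n%:R * p j) ^+ 2 + t / 2))).
  apply: ler_iid_mean => s _; rewrite add0r; set y := (_ - _).
  have -> : y ^+ 2 = `|y| ^+ 2 by rewrite real_normK // num_real.
  (* AM-GM: |y| <= y^2/(2t) + t/2 *)
  rewrite -subr_ge0; have -> : t^-1 / 2 * `|y| ^+ 2 + t / 2 - `|y| = t^-1 / 2 * (`|y| - t) ^+ 2.
    by field; rewrite gt_eqF.
  by rewrite mulr_ge0 ?sqr_ge0 // divr_ge0 // ltW.
rewrite iid_meanD (iid_meanZ n (t^-1 / 2)) iid_mean_count_var iid_mean_cst expr0n /= add0r.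
have pj1 : p j <= 1 by rewrite -p_sum (bigD1 j) //= lerDl sumr_ge0.
have pj0 := p_ge0 j; have n0 : 0 <= n%:R :> R by rewrite ler0n.
have h : n%:R * (p j * (1 - p j)) <= n%:R.
  by rewrite -[leRHS]mulr1 ler_wpM2l //; nra.
have := ler_wpM2l (ltW t0') h; lra.
Qed.

End IidMean.

(** * [DNF] and [OPT] of independent random items *)

Section IidPacking.
Variables (R : realType) (T : finType) (p : T -> R) (a : T -> R).
Hypotheses (p_ge0 : forall j, 0 <= p j) (p_sum : \sum_j p j = 1).
Hypothesis a_itv : forall j, 0 <= a j <= 1.

Local Notation iid_mean := (iid_mean p).
Local Notation iid_DNF n := (iid_mean n (fun s => (DNF (map a s))%:R)).

Let item_map s : is_item_list (map a s).
Proof. by apply/allP => _ /mapP[j _ ->]. Qed.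

Lemma iid_DNF_ge0 n : 0 <= iid_DNF n.
Proof. by rewrite -(iid_mean_cst p_sum n 0); apply: ler_iid_mean. Qed.

Lemma iid_DNF_cat m n : iid_DNF m + iid_DNF n <= iid_DNF (m + n) <= iid_DNF m + iid_DNF n + 1.
Proof.
have e c : iid_DNF m + iid_DNF n + c =
    iid_mean m (fun s => iid_mean n (fun t => (DNF (map a s))%:R + (DNF (map a t))%:R + c)).
  transitivity (iid_mean m (fun s => (DNF (map a s))%:R + (iid_DNF n + c))).
    by rewrite iid_meanD iid_mean_cst // addrA.
  apply: eq_iid_mean => // s _; rewrite iid_meanD iid_mean_cst // iid_meanD iid_mean_cst //.
  by rewrite addrA.
rewrite -[X in X <= _ <= _]addr0 !e iid_mean_cat; apply/andP.
split; apply: ler_iid_mean => // s _; apply: ler_iid_mean => // t _; rewrite map_cat;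
  have /andP[h1 h2] := DNF_cat (item_map s) (item_map t).
  by rewrite addr0 -natrD ler_nat.
by rewrite -natrD natr1 ler_nat -addnS.
Qed.

(** The [n] draws are extended to whole blocks of length [K], at most [n / K + 1] of them, and each
    junction gains at most one bin. *)
Lemma iid_DNF_block n K : (0 < K)%N ->
  iid_DNF n <= (n%:R / K%:R + 1) * (iid_DNF K + 1).
Proof.
move=> K0; have D0 := iid_DNF_ge0.
have mulD q : iid_DNF (q * K) <= q%:R * (iid_DNF K + 1).
  elim: q => [|q IH]; first by rewrite mul0n /= mul0r.
  have /andP[_] := iid_DNF_cat K (q * K); rewrite mulSn -natr1; move: IH; lra.
have nle : (n <= (n %/ K).+1 * K)%N by rewrite ltnW // ltn_ceil.
have /andP[h _] := iid_DNF_cat n ((n %/ K).+1 * K - n); rewrite subnKC // in h.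
apply: (@le_trans _ _ (iid_DNF ((n %/ K).+1 * K))).
  by apply: le_trans h; rewrite lerDl.
apply: (le_trans (mulD _)); rewrite -natr1 ler_wpM2r ?addr_ge0 // lerD2r.
by rewrite ler_pdivlMr ?ltr0n // -natrM ler_nat leq_trunc_div.
Qed.

(** Up to order, [s] contains [m] disjoint copies of the full item set, and each copy can be packed
    optimally on its own. *)
Lemma OPT_copies m (s : seq T) : (forall j, m <= count_mem j s)%N ->
  (m * OPT (map a (enum T)) <= OPT (map a s))%N.
Proof.
move=> ms; pose c m := flatten (nseq m (enum T)).
have mc n : (n * OPT (map a (enum T)) <= OPT (map a (c n)))%N.
  elim: n => //= n IH; rewrite mulSn /c /= map_cat.
  by apply: leq_trans (OPT_cat (item_map _) (item_map _)); rewrite leq_add2l.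
have /count_subseqP[s' ss' cs'] : forall j, (count_mem j (c m) <= count_mem j s)%N.
  move=> j; apply: leq_trans (ms j); rewrite /c count_flatten map_nseq sumn_nseq.
  by rewrite count_uniq_mem ?enum_uniq // mem_enum mul1n.
have [r sr] := perm_to_subseq ss'; apply: (leq_trans (mc m)).
have e : perm_eq (map a (c m) ++ map a r) (map a s).
  rewrite -map_cat perm_map // perm_sym (perm_trans sr) // perm_sym.
  by rewrite perm_cat2r.
apply: leq_trans (leq_OPT_perm e).
exact: leq_trans (leq_addr _ _) (OPT_cat (item_map _) (item_map _)).
Qed.

End IidPacking.

(** A separate [N] with [size L = N] avoids transporting permutations between ['S_(size L)] and
    ['S_N]. *)
Lemma expect_perm_nth (R : realType) (N : nat) (L : seq R) (a : 'I_N -> R) f :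
  size L = N -> (forall i : 'I_N, L`_i = a i) ->
  expect_perm f L = (\sum_(s : 'S_N) f [seq a (s i) | i : 'I_N]) / #|{: 'S_N}|%:R.
Proof.
move=> sL; subst N => La; rewrite /expect_perm; congr (_ / _).
apply: eq_bigr => s _; congr f; rewrite /permuted.
by apply: eq_map => i /=; rewrite La.
Qed.

(** * Uniform draws from [N] items, with and without replacement *)

Section UniformMean.
Variables (R : realType) (N : nat).
Hypothesis N_gt0 : (0 < N)%N.
Variable a : 'I_N -> R.
Hypothesis a_itv : forall j, 0 <= a j <= 1.

Local Notation unif := (fun _ : 'I_N => N%:R^-1 : R).
Local Notation iid_mean := (iid_mean unif).

Let NR0 : 0 < N%:R :> R. Proof. by rewrite ltr0n. Qed.

Let unif_ge0 : forall j, 0 <= unif j.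
Proof. by move=> j; rewrite invr_ge0 ltW. Qed.

Let unif_sum : \sum_j unif j = 1.
Proof. by rewrite sumr_const card_ord -[_ *+ _]mulr_natr mulVf // gt_eqF. Qed.

(** With [m * m] draws, the deviation bound at [t = m] is [m] for each item; summing over the [N]
    items gives the loss [N * m]. *)
Lemma iid_OPT_lower m : (0 < m)%N ->
  (OPT (map a (enum 'I_N)))%:R * ((m * m)%:R / N%:R - (N * m)%:R) <=
  iid_mean (m * m) (fun s => (OPT (map a s))%:R).
Proof.
move=> m0; set k := OPT _; set n := (m * m)%N.
have mR0 : 0 < m%:R :> R by rewrite ltr0n.
apply: (@le_trans _ _ (iid_mean n (fun s =>
   k%:R * (n%:R / N%:R + - 1 * \sum_j `|(count_mem j s)%:R - n%:R / N%:R|)))).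
  rewrite iid_meanZ iid_meanD iid_mean_cst // iid_meanZ iid_mean_sum.
  rewrite ler_wpM2l // lerD2l mulN1r lerN2 [in leRHS]natrM [leRHS]mulrC.
  have := @iid_mean_count_dev R _ _ unif_ge0 unif_sum n _ m%:R mR0 => h.
  apply: (le_trans (ler_sum _ (fun j _ => h j))).
  rewrite sumr_const card_ord -[_ *+ _]mulr_natr ler_wpM2r //.
  by rewrite /n natrM mulfK ?gt_eqF //; lra.
apply: ler_iid_mean => // s _.
(* The rarest item [j] gives the number of full copies available; its count falls short of the mean
   by at most the sum of all deviations. *)
have [j _ jmin] := arg_minnP (fun j => count_mem j s) (erefl : predT (Ordinal N_gt0)).
have := OPT_copies a_itv (fun i => jmin i isT); rewrite -/k -(ler_nat R) natrM.
apply: le_trans; rewrite mulrC ler_wpM2r // mulN1r lerBlDr addrC -lerBlDr.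
rewrite (bigD1 j) //= -[leLHS]addr0 lerD ?sumr_ge0 //.
by rewrite -normrN opprB ler_norm.
Qed.

(** One more draw coincides with one of the other [n] with probability at most [n / N], and
    [n + n ^ 2 <= (n + 1) ^ 2]. *)
Lemma iid_mean_not_uniq n :
  iid_mean n (fun s => (~~ uniq s)%:R) <= n%:R ^+ 2 / N%:R.
Proof.
elim: n => [|n IH] /=; first by rewrite expr0n /= mul0r.
apply: (@le_trans _ _ (\sum_j N%:R^-1 *
    iid_mean n (fun s => (j \in s)%:R + (~~ uniq s)%:R))).
  apply: ler_sum => j _; rewrite ler_wpM2l //; apply: ler_iid_mean => // s _.
  by rewrite negb_and negbK -natrD ler_nat; case: (j \in s); case: (uniq s).
have h : iid_mean n (fun s => \sum_j (j \in s)%:R) <= n%:R.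
  rewrite -[leRHS](iid_mean_cst unif_sum n); apply: ler_iid_mean => // s <-.
  have -> : \sum_j (j \in s)%:R = #|s|%:R :> R; last by rewrite ler_nat card_size.
  by rewrite -sum1_card natr_sum [RHS]big_mkcond; apply: eq_bigr => j _; case: (j \in s).
under eq_bigr do rewrite iid_meanD mulrDr.
rewrite big_split /= -!mulr_sumr -iid_mean_sum sumr_const card_ord.
rewrite -[X in _ + _ * X]mulr_natl mulrA mulVf ?gt_eqF // mul1r.
apply: (le_trans (lerD (ler_wpM2l _ h) IH)) => //.
rewrite mulrC -mulrDl ler_wpM2r // -[n.+1%:R]natr1.
by have : 0 <= n%:R :> R by []; nra.
Qed.

Lemma iid_mean_relabel n (s : 'S_N) f :
  iid_mean n (fun t => f (map s t)) = iid_mean n f.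
Proof.
elim: n f => [|n IH] f //=; rewrite [RHS](reindex_inj (@perm_inj _ s)) /=.
by apply: eq_bigr => j _; rewrite -[in RHS]IH.
Qed.

Definition perm_mean (g : 'S_N -> R) : R := (\sum_s g s) / #|{: 'S_N}|%:R.

Let NS0 : 0 < #|{: 'S_N}|%:R :> R.
Proof. by rewrite ltr0n; apply/card_gt0P; exists 1%g. Qed.

Lemma ler_perm_mean g h : (forall s, g s <= h s) -> perm_mean g <= perm_mean h.
Proof. by move=> gh; rewrite ler_wpM2r ?invr_ge0 ?(ltW NS0) // ler_sum. Qed.

Lemma perm_mean_cst c : perm_mean (fun=> c) = c.
Proof. by rewrite /perm_mean sumr_const -[_ *+ _]mulr_natr mulfK // gt_eqF. Qed.

Lemma perm_meanD g h : perm_mean (fun s => g s + h s) = perm_mean g + perm_mean h.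
Proof. by rewrite /perm_mean big_split mulrDl. Qed.

(** A duplicate-free [t] extends to an enumeration of ['I_N], which is the image of the standard one
    under a permutation. *)
Lemma map_perm_take (t : seq 'I_N) : uniq t ->
  exists s : 'S_N, t = map s (take (size t) (enum 'I_N)).
Proof.
move=> ut; pose u := t ++ [seq x <- enum 'I_N | x \notin t].
have /tuple_permP[s us] : perm_eq u (ord_tuple N).
  rewrite val_ord_tuple; apply: uniq_perm; rewrite ?enum_uniq //.
    rewrite cat_uniq ut filter_uniq ?enum_uniq // andbT /=.
    by apply/hasPn => x; rewrite mem_filter => /andP[].
  by move=> x; rewrite mem_cat mem_filter mem_enum andbT orbN.
exists s; rewrite map_take; have <- : u = map s (enum 'I_N).
  by rewrite us /=; apply: eq_map => i; rewrite tnth_ord_tuple.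
by rewrite take_size_cat.
Qed.

(** A random permutation sends any duplicate-free list to a uniform sample without replacement:
    composing with a fixed permutation only reindexes the group. *)
Lemma perm_mean_uniq (f : seq 'I_N -> R) (t t' : seq 'I_N) :
  uniq t -> uniq t' -> size t = size t' ->
  perm_mean (fun s => f (map s t)) = perm_mean (fun s => f (map s t')).
Proof.
have red u : uniq u -> perm_mean (fun s => f (map s u)) =
    perm_mean (fun s => f (map s (take (size u) (enum 'I_N)))).
  move=> uu; have [r ur] := map_perm_take uu; rewrite /perm_mean; congr (_ / _).
  rewrite [RHS](reindex_inj (mulgI r)) /=; apply: eq_bigr => s _.
  rewrite {1}ur -map_comp; congr f; apply: eq_map => i /=.
  by rewrite permM.
by move=> ut ut' e; rewrite (red t) // (red t') // e.
Qed.

Local Notation perm_DNF t := (perm_mean (fun s => (DNF (map a (map s t)))%:R)).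

Let item_map s : is_item_list (map a s).
Proof. by apply/allP => _ /mapP[j _ ->]. Qed.

(** By symmetry each of [q] disjoint blocks of [K] items has the same mean, and [DNF] is
    superadditive under concatenation. *)
Lemma perm_DNF_blocks K q t : (K <= N)%N -> uniq t -> (q * K <= size t)%N ->
  q%:R * perm_DNF (take K (enum 'I_N)) <= perm_DNF t.
Proof.
move=> KN; elim: q t => [|q IH] t ut qt.
  by rewrite mul0r -(perm_mean_cst 0); apply: ler_perm_mean.
have Kt : (K <= size t)%N by apply: leq_trans qt; rewrite mulSn leq_addr.
apply: (@le_trans _ _ (perm_DNF (take K t) + perm_DNF (drop K t))).
  rewrite -natr1 mulrDl mul1r addrC lerD //.
    rewrite le_eqVlt (perm_mean_uniq (fun t => (DNF (map a t))%:R) (t' := take K t)) ?eqxx //.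
    - by rewrite take_uniq // enum_uniq.
    - exact: take_uniq.
    - by rewrite !size_takel // -[size _]cardE card_ord.
  apply: IH; first exact: drop_uniq.
  by rewrite size_drop leq_subRL // -mulSn.
rewrite -perm_meanD; apply: ler_perm_mean => s.
rewrite -natrD ler_nat -{3}(cat_take_drop K t) !map_cat.
by have /andP[] := DNF_cat (item_map (map s (take K t))) (item_map (map s (drop K t))).
Qed.

(** Without a collision the [K] draws form a sample without replacement. With one, of probability at
    most [K ^ 2 / N], [DNF] is at most [K]. *)
Lemma iid_DNF_perm K : (K <= N)%N ->
  iid_mean K (fun t => (DNF (map a t))%:R) <=
  perm_DNF (take K (enum 'I_N)) + K%:R * (K%:R ^+ 2 / N%:R).
Proof.
move=> KN; set e := perm_DNF _.
(* Relabelling the items leaves the law of the draws unchanged, so each [t] may be averaged over all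
   relabellings. *)
have -> : iid_mean K (fun t => (DNF (map a t))%:R) = iid_mean K (fun t => perm_DNF t).
  transitivity (iid_mean K (fun t => #|{: 'S_N}|%:R^-1 *
      \sum_(s : 'S_N) (DNF (map a (map s t)))%:R)); last first.
    by apply: eq_iid_mean => // t _; rewrite mulrC.
  rewrite iid_meanZ iid_mean_sum -[LHS]perm_mean_cst /perm_mean mulrC.
  congr (_ * _); apply: eq_bigr => s _.
  by rewrite -(iid_mean_relabel K s).
apply: (@le_trans _ _ (iid_mean K (fun t => e + K%:R * (~~ uniq t)%:R))).
  apply: ler_iid_mean => // t tK; have [ut|_] := boolP (uniq t).
    rewrite mulr0 addr0 le_eqVlt /e (perm_mean_uniq (fun t => (DNF (map a t))%:R) ut
      (take_uniq K (enum_uniq 'I_N))) ?eqxx //.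
    by rewrite size_takel // -[size (enum _)]cardE card_ord.
  rewrite mulr1 -[leLHS]add0r lerD //.
    by rewrite -(perm_mean_cst 0); apply: ler_perm_mean.
  rewrite -(perm_mean_cst K%:R); apply: ler_perm_mean => s.
  by rewrite ler_nat (leq_trans (DNF_from_size _ _)) // !size_map tK.
by rewrite iid_meanD iid_mean_cst // iid_meanZ lerD2l ler_wpM2l // iid_mean_not_uniq.
Qed.

Lemma expect_permE f :
  expect_perm f (map a (enum 'I_N)) = perm_mean (fun s => f (map a (map s (enum 'I_N)))).
Proof.
rewrite (@expect_perm_nth _ N _ a) => [||i].
- congr (_ / _); apply: eq_bigr => s _; congr f.
  by rewrite -map_comp.
- by rewrite size_map -[size _]cardE card_ord.
- by rewrite (nth_map i) ?nth_ord_enum // -[size _]cardE card_ord.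
Qed.

End UniformMean.

(** * Sums against the product law as recursive expectations; exchangeability *)

Section Bridge.
Variable R : realType.
Implicit Type F : discrete_distribution.

Lemma sum_ffun_recl (T : finType) n (G : {ffun 'I_n.+1 -> T} -> R) :
  \sum_w G w = \sum_(j : T) \sum_(w : {ffun 'I_n -> T})
    G [ffun i => if unlift ord0 i is Some i' then w i' else j].
Proof.
rewrite pair_big /=; rewrite (reindex (fun jw : T * {ffun 'I_n -> T} =>
  [ffun i => if unlift ord0 i is Some i' then jw.2 i' else jw.1])) //=.
exists (fun w => (w ord0, [ffun i => w (lift ord0 i)])) => [[j w] _|w _] /=.
  by rewrite ffunE unlift_none; congr pair; apply/ffunP => i; rewrite !ffunE liftK.
by apply/ffunP => i; rewrite !ffunE; case: unliftP => [i' ->|->]; rewrite ?ffunE.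
Qed.

Lemma sum_ffun_iid_mean (T : finType) (p : T -> R) n (f : seq T -> R) :
  \sum_(w : {ffun 'I_n -> T}) (\prod_(i < n) p (w i)) * f [seq w i | i : 'I_n] =
  iid_mean p n f.
Proof.
elim: n f => [|n IH] f /=.
  have e0 (w : {ffun 'I_0 -> T}) : [seq w i | i : 'I_0] = [::].
    by apply: size0nil; rewrite size_map -cardE card_ord.
  under eq_bigr => w _ do rewrite big_ord0 mul1r e0.
  by rewrite sumr_const card_ffun card_ord expn0.
rewrite sum_ffun_recl; apply: eq_bigr => j _; rewrite -IH mulr_sumr.
apply: eq_bigr => w _; rewrite big_ord_recl ffunE unlift_none mulrA; congr (_ * _ * f _).
  by apply: eq_bigr => i _; rewrite ffunE liftK.
rewrite /image_mem enum_ordSl /= ffunE unlift_none; congr cons.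
by rewrite -map_comp; apply: eq_map => i /=; rewrite ffunE liftK.
Qed.

Lemma expect_iidE F n (f : seq R -> R) :
  expect_iid F n f = iid_mean (fun j : 'I_(atoms F) => ratr (item_prob j)) n
    (fun s => f (map (fun j : 'I_(atoms F) => ratr (item_size j)) s)).
Proof.
rewrite -sum_ffun_iid_mean; apply: eq_bigr => w _; congr (_ * f _).
by rewrite -map_comp; apply: eq_map => i.
Qed.

(** Exchangeability: permuting the positions preserves the product weight, so the mean equals its
    average over all permutations. *)
Lemma expect_iid_perm F n (f : seq R -> R) :
  expect_iid F n f = expect_iid F n (expect_perm f).
Proof.
have cS : #|{: 'S_n}|%:R != 0 :> R.
  by rewrite pnatr_eq0 -lt0n; apply/card_gt0P; exists 1%g.
transitivity ((\sum_(s : 'S_n) expect_iid F n f) / #|{: 'S_n}|%:R).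
  by rewrite sumr_const -[X in X / _]mulr_natr mulfK.
have step (s : 'S_n) : expect_iid F n f = \sum_(w : {ffun 'I_n -> 'I_(atoms F)})
    (\prod_(i < n) ratr (item_prob (w i))) * f [seq ratr (item_size (w (s i))) | i : 'I_n].
  rewrite /expect_iid (reindex_inj (h := fun w : {ffun 'I_n -> 'I_(atoms F)} =>
    [ffun i => w (s i)])) /=.
    apply: eq_bigr => w _; congr (_ * f _); last by apply: eq_map => i; rewrite ffunE.
    rewrite [RHS](reindex_inj (@perm_inj _ s)) /=.
    by apply: eq_bigr => i _; rewrite ffunE.
  move=> w v /ffunP wv; apply/ffunP => i.
  by have := wv ((s^-1)%g i); rewrite !ffunE permKV.
rewrite (eq_bigr _ (fun s _ => step s)) exchange_big mulr_suml /=.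
apply: eq_bigr => w _; rewrite -mulr_sumr -mulrA; congr (_ * _).
rewrite (@expect_perm_nth _ n _ (fun i => ratr (item_size (w i)))) //.
  by rewrite size_map -cardE card_ord.
move=> i; rewrite (nth_map i) ?nth_ord_enum //.
by rewrite -[size _]cardE card_ord.
Qed.

End Bridge.

(** * Bounds on lower limits *)

Section LimInf.
Variable R : realType.
Implicit Types (u : (\bar R)^nat) (x : \bar R).

Lemma limn_einf_ge u x : (\forall n \near \oo, (x <= u n)%E) -> (x <= limn_einf u)%E.
Proof.
move=> [M _ xu]; rewrite limn_einf_lim; apply: lime_ge; first exact: is_cvg_einfs.
exists M => // n /= Mn; apply: le_ereal_inf_tmp => _ [m /= nm <-].
exact/xu/(leq_trans Mn).
Qed.

(** Allows the upper bound to be checked only along sample sizes that are squares. *)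
Lemma limn_einf_le u x :
  (forall n, exists2 m, (n <= m)%N & (u m <= x)%E) -> (limn_einf u <= x)%E.
Proof.
move=> ux; rewrite limn_einf_lim; apply: lime_le; first exact: is_cvg_einfs.
apply: nearW => n; have [m nm um] := ux n; apply: ge_ereal_inf.
by exists (u m) => //; exists m.
Qed.

End LimInf.

Lemma ratr_itv01 (R : realType) (q : rat) : (0 <= (ratr q : R) <= 1) = (0 <= q <= 1).
Proof.
have -> : (ratr q <= 1 :> R) = (q <= 1) by rewrite -[1 in LHS](rmorph1 (@ratr R)) ler_rat.
by rewrite ler0q.
Qed.

(** * The inequality [ROR_DNF <= AECR_DNF] *)

Section LowerBound.
Variables (R : realType) (F : discrete_distribution).
Hypothesis ndF : Defs.nondegenerate F.

Let p (j : 'I_(atoms F)) : R := ratr (item_prob j).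
Let a (j : 'I_(atoms F)) : R := ratr (item_size j).

Let p_ge0 j : 0 <= p j. Proof. by rewrite ler0q ltW // item_prob_gt0. Qed.
Let p_sum : \sum_j p j = 1.
Proof. by rewrite -rmorph_sum item_prob_sum rmorph1. Qed.
Let a_itv j : 0 <= a j <= 1.
Proof. by rewrite ratr_itv01 item_size_itv. Qed.

Let a_list s : is_item_list (map a s).
Proof. by apply/allP => _ /mapP[j _ ->]. Qed.

Let mu := \sum_j p j * a j.

Let mu_gt0 : 0 < mu.
Proof.
case: ndF => j j0; rewrite /mu (bigD1 j) //= ltr_pwDl //.
  by rewrite mulr_gt0 // ltr0q // item_prob_gt0.
by apply: sumr_ge0 => i _; rewrite mulr_ge0 //; have /andP[] := a_itv i.
Qed.

Let EO n : R := expect_iid F n (fun L => (OPT L)%:R).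
Let ED n : R := expect_iid F n (fun L => (DNF L)%:R).

Let EO_ge n : n%:R * mu <= 2 * EO n + 1.
Proof.
rewrite /EO expect_iidE -/p -/a -(iid_mean_total p_sum n a).
rewrite -[X in _ <= _ + X](iid_mean_cst p_sum n) -iid_meanZ -iid_meanD.
apply: ler_iid_mean => // s _; have := total_size_OPT (a_list s).
by rewrite /total_size big_map.
Qed.

(** The bound holds list by list before averaging: subtracting [k] makes the left side nonpositive
    on lists with [OPT L < k], where the ratio is not controlled. *)
Let ED_ge n (k : nat) (r : R) : 0 <= r ->
  (forall L, is_item_list L -> (k <= OPT L)%N -> r <= random_order_ratio L) ->
  r * (EO n - k%:R) <= ED n.
Proof.
move=> r0 rL; rewrite /ED expect_iid_perm /EO !expect_iidE -/p -/a.
rewrite -[in leLHS](iid_mean_cst p_sum n k%:R) -mulN1r -iid_meanZ -iid_meanD -iid_meanZ.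
apply: ler_iid_mean => // s _; rewrite mulN1r; set L := map a s.
have E0 : 0 <= expect_perm (fun L' => (DNF L')%:R) L.
  by rewrite divr_ge0 // sumr_ge0.
have [kL|Lk] := leqP k (OPT L); last first.
  apply: le_trans E0; rewrite mulr_ge0_le0 // subr_le0 ler_nat; exact: ltnW.
have := rL L (a_list s) kL; rewrite /random_order_ratio.
(* For [OPT L = 0] the ratio is 0 by the convention on division and says nothing, but the left side
   is again nonpositive. *)
have [->|O0] := posnP (OPT L).
  by move=> _; apply: le_trans E0; rewrite sub0r mulrN oppr_le0 mulr_ge0.
rewrite ler_pdivlMr ?ltr0n //; apply: le_trans.
by rewrite ler_wpM2l // lerBlDr lerDl.
Qed.

Lemma ROR_leq_average_case :
  (ROR_DNF R <= limn_einf (fun n => (average_case_ratio R F n)%:E))%E.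
Proof.
apply: lime_le.
  apply: ereal_nondecreasing_is_cvgn => k m km; apply: ereal_inf_le_tmp.
  by move=> _ [L [iL mL] <-]; exists L => //; split=> //; apply: leq_trans mL.
apply: nearW => k; set rho := ereal_inf _.
have rho_le L : is_item_list L -> (k <= OPT L)%N -> (rho <= (random_order_ratio L)%:E)%E.
  by move=> iL kL; apply: ereal_inf_lbound; exists L.
have rho_ge0 : (0 <= rho)%E.
  apply: le_ereal_inf_tmp => _ [L _ <-]; rewrite lee_fin.
  by rewrite !divr_ge0 // sumr_ge0.
have EOlarge (M : R) : exists n0, forall n, (n0 <= n)%N -> M <= EO n.
  exists (Num.truncn ((2 * M + 1) / mu)).+1 => n n0n.
  have : (2 * M + 1) / mu <= n%:R.
    by apply: ltW; apply: lt_le_trans (truncnS_gt _) _; rewrite ler_nat.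
  by rewrite ler_pdivrMr // => h; have := EO_ge n; lra.
case: rho rho_ge0 rho_le => [r| |] //= r0 rL; last first.
  (* The infimum is not infinite: [k] items of size 1 form an admissible list, whose ratio is
     finite. *)
  have iL : is_item_list (nseq k (1 : R)) by apply/allP => x /nseqP[->]; rewrite ler01 lexx.
  have /(rL _ iL) : (k <= OPT (nseq k (1%R : R)))%N.
    apply: leq_trans (DNF_leq_OPT _); rewrite /DNF.
    by elim: (k) => //= m IH; rewrite add0r lexx ltnS.
  by rewrite leye_eq.
rewrite lee_fin in r0.
apply/lee_addgt0Pr => e e0; rewrite -leeBlDr // -EFinB.
(* This threshold gives [r * k <= e * (EO n - 1)], so the loss from [k] is within [e * EO n]; the
   summand 1 forces [EO n] to be positive. *)
have [n0 n0P] := EOlarge (r * k%:R / e + 1).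
apply: limn_einf_ge; exists n0 => // n /= /n0P; rewrite -lerBrDr.
rewrite ler_pdivrMr // => h; rewrite lee_fin.
have EO0 : 0 < EO n.
  have : 0 <= r * k%:R by rewrite mulr_ge0.
  by nra.
rewrite /average_case_ratio -/(EO n) -/(ED n) ler_pdivlMr //.
have rL' L : is_item_list L -> (k <= OPT L)%N -> r <= random_order_ratio L.
  by move=> iL kL; rewrite -lee_fin; exact: rL.
by have := ED_ge n r0 rL'; lra.
Qed.

End LowerBound.

(** Only finitely many subset sums lie below 1. Rounding up by less, in total, than the smallest gap
    [d] to 1 pushes none of them up to 1. *)
Lemma rational_round (R : realType) (N : nat) (b : 'I_N -> R) :
  (forall i, 0 <= b i <= 1) ->
  exists a : 'I_N -> rat, [/\ forall i, 0 <= a i <= 1, forall i, b i <= ratr (a i) &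
    forall u, uniq u -> (1 <= \sum_(i <- u) b i) = (1 <= \sum_(i <- u) ratr (a i) :> R)].
Proof.
move=> b_itv.
pose d := \big[Num.min/1]_(A : {set 'I_N} | \sum_(i in A) b i < 1) (1 - \sum_(i in A) b i).
have d0 : 0 < d.
  rewrite /d; elim/big_ind: _ => // [x y x0 y0|A A1]; first by rewrite lt_min x0.
  by rewrite subr_gt0.
have dA (A : {set 'I_N}) : \sum_(i in A) b i < 1 -> \sum_(i in A) b i + d <= 1.
  by move=> A1; rewrite addrC -lerBrDr; apply: bigmin_le_cond.
(* Dividing by [N + 1] keeps the total of at most [N] increments strictly below [d]. *)
have e0 : 0 < d / N.+1%:R by rewrite divr_gt0.
have /choice[a aP] : forall i, exists q : rat,
    [/\ b i <= ratr q, ratr q <= 1 :> R & ratr q <= b i + d / N.+1%:R].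
  move=> i; have /andP[b0 b1] := b_itv i.
  (* A size equal to 1 leaves no room above it, but is already rational. *)
  have [->|bi1] := eqVneq (b i) 1.
    by exists 1; rewrite rmorph1 lexx lerDl ltW.
  have : b i < Num.min 1 (b i + d / N.+1%:R).
    by rewrite lt_min ltrDl e0 andbT lt_neqAle bi1.
  by case/rat_in_itvoo => q; rewrite in_itv /= lt_min => /and3P[h1 h2 h3]; exists q; split; exact: ltW.
exists a; split=> [i|i|u uu].
- have [h1 h2 _] := aP i; have /andP[b0 _] := b_itv i.
  by rewrite -(ratr_itv01 R) h2 (le_trans b0).
- by have [] := aP i.
apply/idP/idP => [h|]; first by apply: (le_trans h); apply: ler_sum => i _; have [] := aP i.
apply: contraTT; rewrite -!ltNge => h.
have ub : \sum_(i <- u) b i + d <= 1.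
  have e : \sum_(i <- u) b i = \sum_(i in [set i in u]%SET) b i.
    by rewrite big_uniq //; apply: eq_bigl => i; rewrite finset.inE.
  by rewrite e dA // -e.
apply: lt_le_trans ub.
apply: (@le_lt_trans _ _ (\sum_(i <- u) (b i + d / N.+1%:R))).
  by apply: ler_sum => i _; have [] := aP i.
rewrite big_split /= ltrD2l big_const_seq count_predT iter_addr_0 -[ltLHS]mulr_natr.
have : (size u)%:R <= N%:R :> R.
  by rewrite ler_nat -[N in leqRHS]card_ord -(card_uniqP uu) max_card.
move=> uN; rewrite -[ltRHS](@divfK _ N.+1%:R) ?pnatr_eq0 // ltr_pM2l // -natr1.
by apply: (le_lt_trans uN); rewrite ltrDl.
Qed.

(** Here [x], [y], [k], [M] are [N], [K], [OPT L] and [m] for a sample of [M * M] items, and [D] is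
    the block mean plus one. The slack [e] contributes [e * k / x] times [M * M], which outweighs
    the terms of lower order once [M] is large. *)
Lemma sample_arith (R : realFieldType) (M x y k D e : R) :
  0 < x -> 0 < y -> 0 < k -> 0 <= D -> 0 < e -> 1 <= M -> x * x < M ->
  (D + (D * x / y / k + e) * k * x) / (e * k / x) <= M ->
  0 < k * (M * M / x - x * M) /\
  (M * M / y + 1) * D <= (D * x / y / k + e) * (k * (M * M / x - x * M)).
Proof.
move=> x0 y0 k0 D0 e0 M1 xM; set C := _ + e => mD; split.
  have -> : M * M / x - x * M = M * (M - x * x) / x by field; rewrite gt_eqF.
  by rewrite mulr_gt0 // divr_gt0 // mulr_gt0 ?subr_gt0 // (lt_le_trans ltr01).
rewrite ler_pdivrMr in mD; last by rewrite divr_gt0 ?mulr_gt0.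
have Ck : C * k / x = D / y + e * k / x by rewrite /C; field; rewrite !gt_eqF.
have -> : C * (k * (M * M / x - x * M)) = (C * k / x) * (M * M) - C * k * x * M.
  by field; rewrite gt_eqF.
have -> : (M * M / y + 1) * D = D / y * (M * M) + D by field; rewrite gt_eqF.
have M0 : 0 <= M by rewrite (le_trans ler01).
rewrite Ck; have := ler_wpM2r M0 mD; have := ler_wpM2l D0 M1.
by rewrite (mulrC M) !mulrA; lra.
Qed.

(** * The uniform distribution on the items of a rational list *)

Section UpperBound.
Variables (R : realType) (N : nat) (b : 'I_N -> rat).
Hypotheses (N_gt0 : (0 < N)%N) (b_itv : forall j, 0 <= b j <= 1).

Let a (j : 'I_N) : R := ratr (b j).
Let L := map a (enum 'I_N).

Let a_itv j : 0 <= a j <= 1.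
Proof. by rewrite ratr_itv01. Qed.

Let probs_gt0 (j : 'I_N) : 0 < N%:R^-1 :> rat.
Proof. by rewrite invr_gt0 ltr0n. Qed.

Let probs_sum : \sum_(j < N) N%:R^-1 = 1 :> rat.
Proof.
by rewrite sumr_const card_ord -[_ *+ _]mulr_natr mulVf // pnatr_eq0 -lt0n.
Qed.

Let F := DiscreteDistribution b_itv probs_gt0 probs_sum.

Let F_mean n f : expect_iid F n f = iid_mean (fun=> N%:R^-1 : R) n (fun s => f (map a s)).
Proof.
rewrite expect_iidE; congr (iid_mean _ _ _).
by apply/funext => j; rewrite -(ratr_nat R N) -fmorphV.
Qed.

(** Block subadditivity of [DNF] and the linear growth of [OPT] bound the average-case ratio through
    the mean on [K] draws. That mean is compared with [N %/ K] blocks of the permuted list, up to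
    collisions. *)
Lemma AECR_le_sample (K : nat) : (0 < K <= N)%N -> (0 < OPT L)%N ->
  (AECR_DNF R <= ((expect_perm (fun L' => (DNF L')%:R) L / (N %/ K)%:R +
      K%:R ^+ 3 / N%:R + 1) * N%:R / K%:R / (OPT L)%:R)%:E)%E.
Proof.
move=> /andP[K0 KN] O0; set E := expect_perm _ _.
have NR0 : 0 < N%:R :> R by rewrite ltr0n.
have KR0 : 0 < K%:R :> R by rewrite ltr0n.
have OR0 : 0 < (OPT L)%:R :> R by rewrite ltr0n.
have unif_ge0 : forall j : 'I_N, 0 <= N%:R^-1 :> R by rewrite invr_ge0.
have unif_sum : \sum_(j < N) N%:R^-1 = 1 :> R.
  by rewrite sumr_const card_ord -[_ *+ _]mulr_natr mulVf // gt_eqF.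
pose D := iid_mean (fun=> N%:R^-1 : R) K (fun s => (DNF (map a s))%:R) + 1.
have D0 : 0 <= D.
  by rewrite addr_ge0 // (iid_DNF_ge0 a unif_ge0 unif_sum).
have DE : D <= E / (N %/ K)%:R + K%:R ^+ 3 / N%:R + 1.
  rewrite lerD2r; apply: (le_trans (iid_DNF_perm N_gt0 a KN)).
  rewrite [_ ^+ 3]exprS -[K%:R * _ / _]mulrA lerD2r ler_pdivlMr ?ltr0n ?divn_gt0 // mulrC /E expect_permE.
  apply: (perm_DNF_blocks a_itv KN); rewrite ?enum_uniq //.
  by rewrite -[size _]cardE card_ord leq_trunc_div.
apply: (@le_trans _ _ (D * N%:R / K%:R / (OPT L)%:R)%:E); last first.
  by rewrite lee_fin !ler_pM2r ?invr_gt0.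
apply/lee_addgt0Pr => e e0; rewrite -EFinD; set C := _ + _.
apply: (@le_trans _ _ (limn_einf (fun n : nat => (average_case_ratio R F n)%:E))).
  apply: ereal_inf_lbound; exists F => //.
  (* If all sizes vanished, bin 0 of an optimal labelling would have total size 0. *)
  apply: contrapT => b0; have [q qL /(_ 0%N O0)] := OPT_labelling L.
  rewrite big_seq_cond big1 ?ler10 // => x /andP[xq _].
  have : x.1 \in L by rewrite -qL map_f.
  case/mapP => j _ ->; apply/eqP; rewrite eq_le; have /andP[-> _] := a_itv j.
  rewrite andbT leNgt; apply/negP; rewrite ltr0q => bj; apply: b0.
  by exists j.
apply: limn_einf_le => n.
have C0 : 0 <= C by rewrite addr_ge0 ?(ltW e0) // !divr_ge0 // mulr_ge0.
pose k : R := (OPT L)%:R.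
(* The three conditions place [m] beyond [n], make the lower bound on the mean of [OPT] positive,
   and let [e] absorb the terms of lower order. *)
have [m [mn mN mD]] : exists m, [/\ (n < m)%N, (N * N < m)%N &
    (D + C * k * N%:R) / (e * k / N%:R) <= m%:R].
  exists (n + N * N + Num.truncn ((D + C * k * N%:R) / (e * k / N%:R))).+1.
  split; rewrite ?ltnS; [by rewrite -addnA leq_addr | by rewrite addnAC leq_addl |].
  apply: ltW; apply: lt_le_trans (truncnS_gt _) _.
  by rewrite ler_nat ltnS leq_addl.
have m0 : (0 < m)%N by apply: leq_ltn_trans mn.
exists (m * m)%N; first by rewrite (leq_trans (ltnW mn)) // leq_pmulr.
rewrite lee_fin /average_case_ratio !F_mean.
have hO := iid_OPT_lower N_gt0 a_itv m0.
have hD := iid_DNF_block unif_ge0 unif_sum a_itv (m * m) K0.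
rewrite -/L -/k -/D in hO hD.
have mR0 : 1 <= m%:R :> R by rewrite ler1n.
have mNR : N%:R * N%:R < m%:R :> R by rewrite -natrM ltr_nat.
rewrite !natrM in hO hD.
have [pos le] := sample_arith NR0 KR0 OR0 D0 e0 mR0 mNR mD.
rewrite ler_pdivrMr; last exact: lt_le_trans hO.
by apply: (le_trans hD); apply: (le_trans le); apply: ler_wpM2l.
Qed.

End UpperBound.

(** * Passage to real sizes, and the choice of the block length *)

Section RealLists.
Variable R : realType.
Implicit Types L : seq R.

Lemma perm_eq_permuted L (s : 'S_(size L)) : perm_eq (permuted s) L.
Proof.
rewrite -[X in perm_eq _ X]map_nth_enum /permuted.
have -> : [seq L`_(s i) | i : 'I_(size L)] = map (fun i : 'I_(size L) => L`_i) (map s (enum 'I_(size L))).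
  by rewrite -map_comp; apply: eq_map => i.
apply: perm_map.
apply: uniq_perm; rewrite ?enum_uniq ?(map_inj_uniq perm_inj) ?enum_uniq // => i.
by rewrite mem_enum -{1}[i](permKV s) map_f // mem_enum.
Qed.

Lemma random_order_ratio_le1 L : random_order_ratio L <= 1.
Proof.
rewrite /random_order_ratio; have [->|O0] := posnP (OPT L); first by rewrite invr0 mulr0 ler01.
rewrite ler_pdivrMr ?ltr0n // mul1r /expect_perm ler_pdivrMr; last first.
  by rewrite ltr0n; apply/card_gt0P; exists 1%g.
rewrite mulr_natr -sumr_const; apply: ler_sum => s _; rewrite ler_nat.
exact: leq_trans (DNF_leq_OPT _) (leq_OPT_perm (perm_eq_permuted s)).
Qed.

(** Rounding up leaves [DNF] of every permutation unchanged and cannot lower [OPT], so the bound for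
    the rounded list implies this one. *)
Lemma AECR_le_list L (K : nat) :
  is_item_list L -> (0 < K <= size L)%N -> (0 < OPT L)%N ->
  (AECR_DNF R <= ((random_order_ratio L * (OPT L)%:R / (size L %/ K)%:R +
      K%:R ^+ 3 / (size L)%:R + 1) * (size L)%:R / K%:R / (OPT L)%:R)%:E)%E.
Proof.
move=> /allP iL KN O0; have /andP[K0 Ks] := KN.
have L_itv (i : 'I_(size L)) : 0 <= L`_i <= 1 by apply/iL/mem_nth.
have [b [b_itv Lb bS]] := rational_round L_itv.
set L' := map (fun i => ratr (b i) : R) (enum 'I_(size L)).
have OO : (OPT L <= OPT L')%N by rewrite -{1}[L]map_nth_enum leq_OPT_map.
have EE : expect_perm (fun l => (DNF l)%:R : R) L' = expect_perm (fun l => (DNF l)%:R) L.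
  rewrite (@expect_perm_nth _ (size L) L' (fun i => ratr (b i))).
  - congr (_ / _); apply: eq_bigr => s _; congr (_%:R).
    have mapE (h : 'I_(size L) -> R) : [seq h (s i) | i : 'I_(size L)] = map h (map s (enum 'I_(size L))).
      by rewrite -map_comp; apply: eq_map => i.
    rewrite /permuted (mapE (fun i => ratr (b i))) (mapE (fun i : 'I_(size L) => L`_i)).
    by apply/esym/DNF_eq_map => //; rewrite (map_inj_uniq perm_inj) enum_uniq.
  - by rewrite size_map -[size (enum _)]cardE card_ord.
  - by move=> i; rewrite (nth_map i) ?nth_ord_enum // -[size (enum _)]cardE card_ord.
have O0' : (0 < OPT L')%N by apply: leq_trans OO.
apply: (le_trans (AECR_le_sample (leq_trans K0 Ks) b_itv KN O0')).
have N0 : 0 < (size L)%:R :> R by rewrite ltr0n (leq_trans K0).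
rewrite lee_fin -/L' EE /random_order_ratio divfK ?gt_eqF ?ltr0n //.
rewrite ler_wpM2l ?lef_pV2 ?posrE ?ltr0n ?ler_nat //.
have E0 : 0 <= expect_perm (fun l => (DNF l)%:R) L by rewrite divr_ge0 // sumr_ge0.
by rewrite !divr_ge0 // mulr_ge0 // !addr_ge0 // divr_ge0.
Qed.

(** For [c] the cube root of [N] and [c < K <= 2 * c], the incomplete last block costs at most
    [1 / A], collisions [16 / A], and the extra bin per block [4 / A]: in all [21 / A]. *)
Lemma AECR_le_large_list L (A : R) : is_item_list L -> 4 <= A ->
  A <= total_size L / (size L)%:R `^ (2 / 3) ->
  (AECR_DNF R <= (random_order_ratio L + 21 / A)%:E)%E.
Proof.
move=> iL A4 As; set N := size L in As *; set n : R := N%:R in As *.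
have A0 : 0 < A by lra.
have N0 : (0 < N)%N.
  (* For an empty list the quotient in [As] is 0 by the convention on division, contradicting
     [0 < A]. *)
  rewrite lt0n; apply/negP => /eqP N0; move: As; rewrite /n N0 powR0 ?invr0 ?mulr0; first lra.
  by rewrite gt_eqF // divr_gt0.
have n1 : 1 <= n by rewrite ler1n.
have n0 : 0 < n by lra.
pose c := n `^ 3^-1.
have c3 : c ^+ 3 = n by rewrite -powR_mulrn ?powR_ge0 // -powRrM mulVf ?powRr1 ?ltW // pnatr_eq0.
have c2 : n `^ (2 / 3) = c ^+ 2 by rewrite mulrC powRrM powR_mulrn ?powR_ge0.
have c1 : 1 <= c.
  by rewrite -(powRr0 n); apply: ler_powR; rewrite ?invr_ge0.
have c0 : 0 < c by lra.
rewrite c2 ler_pdivlMr ?exprn_gt0 // in As.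
have sn : total_size L <= c ^+ 3.
  rewrite c3 /n /N -sum1_size natr_sum /total_size big_seq [leRHS]big_seq.
  by apply: ler_sum => a /(allP iL)/andP[].
have Ac : A <= c by move: (le_trans As sn); rewrite [c ^+ 3]exprS ler_pM2r ?exprn_gt0.
have sO := total_size_OPT iL; set k : R := (OPT L)%:R in sO *.
(* The left side is at most [2 * k + 1], and being at least 4 it absorbs the 1. *)
have kc : A * c ^+ 2 <= 4 * k.
  have : 1 <= c ^+ 2 by rewrite exprn_ege1.
  by nra.
have k0 : 0 < k.
  have : 0 < A * c ^+ 2 by rewrite mulr_gt0 ?exprn_gt0.
  by lra.
pose K := (Num.truncn c).+1.
have cK : c < K%:R by apply: truncnS_gt.
have Kc : K%:R <= 2 * c.
  have : (Num.truncn c)%:R <= c by rewrite truncn_le ltW.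
  by rewrite /K -natr1; lra.
have K0 : 0 < K%:R :> R by lra.
have KN : (0 < K <= N)%N.
  rewrite ltr0n in K0; rewrite K0 /= -(ler_nat R) -/n -c3 (le_trans Kc) //.
  by rewrite exprSr ler_pM2r //; nra.
have q_ceil : n < ((N %/ K)%:R + 1) * K%:R.
  by rewrite natr1 -natrM ltr_nat ltn_ceil // -(ltr0n R).
set q : R := (N %/ K)%:R in q_ceil.
(* [q] exceeds [c ^+ 2 / 2 - 1], which is at least [A] since [c >= A >= 4]. *)
have qA : A <= q.
  have : c ^+ 2 < 2 * (q + 1).
    rewrite -(ltr_pM2r c0) -exprSr c3; apply: (lt_le_trans q_ceil).
    by rewrite -mulrA mulrCA ler_wpM2l // addr_ge0.
  by nra.
have q0 : 0 < q by lra.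
have O0 : (0 < OPT L)%N by rewrite -(ltr0n R).
apply: (le_trans (AECR_le_list iL KN O0)); rewrite lee_fin -/n -/q -/k -/N.
set x := random_order_ratio L; set y : R := K%:R in Kc cK K0 q_ceil *.
have x1 : x <= 1 by apply: random_order_ratio_le1.
have x0 : 0 <= x by rewrite !divr_ge0 // sumr_ge0.
have -> : (x * k / q + y ^+ 3 / n + 1) * n / y / k = x * (n / (q * y)) + y ^+ 2 / k + n / (y * k).
  by field; rewrite !gt_eqF.
have h1 : n / (q * y) <= 1 + 1 / A.
  rewrite ler_pdivrMr ?mulr_gt0 //; apply: (le_trans (ltW q_ceil)).
  have -> : (q + 1) * y = (1 + 1 / q) * (q * y) by field; rewrite gt_eqF.
  rewrite ler_pM2r ?mulr_gt0 // lerD2l !mul1r lef_pV2 //.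
have h2 : y ^+ 2 / k <= 16 / A.
  rewrite ler_pdivrMr // mulrAC ler_pdivlMr //.
  have : y ^+ 2 <= 4 * c ^+ 2 by nra.
  by nra.
have h3 : n / (y * k) <= 4 / A.
  rewrite ler_pdivrMr ?mulr_gt0 // mulrAC ler_pdivlMr // -c3.
  have : c * (A * c ^+ 2) <= y * (4 * k).
    by apply: ler_pM; rewrite ?mulr_ge0 ?exprn_ge0 ?(ltW A0) ?(ltW c0) ?(ltW cK).
  by rewrite exprS; lra.
have : x * (n / (q * y)) <= x * (1 + 1 / A) by rewrite ler_wpM2l.
have : x * (1 / A) <= 1 / A by rewrite ler_piMl // divr_ge0 // ltW.
by move: h2 h3; lra.
Qed.

End RealLists.

Theorem theorem3 (R : realType) :
  (exists L : nat -> seq R,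
     [/\ forall i, is_item_list (L i),
         (random_order_ratio (L i))%:E @[i --> \oo] --> ROR_DNF R
       & total_size (L i) / (size (L i))%:R `^ (2 / 3) @[i --> \oo] --> +oo]) ->
  ROR_DNF R = AECR_DNF R.
Proof.
case=> L [iL ratioL sizeL]; apply/eqP; rewrite eq_le; apply/andP; split.
  apply: le_ereal_inf_tmp => _ [F ndF <-]; exact: ROR_leq_average_case.
apply/lee_addgt0Pr => e e0; rewrite -leeBlDr //.
(* The term 4 meets the hypothesis of [AECR_le_large_list], and [21 / e] makes its error at most
   [e]. *)
pose A : R := 4 + 21 / e.
have A4 : 4 <= A by rewrite lerDl divr_ge0 // ltW.
have Ae : 21 / A <= e.
  rewrite ler_pdivrMr ?(lt_le_trans _ A4) // /A mulrDr mulrCA divff ?gt_eqF //; nra.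
rewrite -(cvg_lim _ ratioL) //; apply: lime_ge.
  by apply/cvg_ex; exists (ROR_DNF R).
move/cvgryPge : sizeL => /(_ A); apply: filterS => i hi.
rewrite leeBlDr // -EFinD; apply: (le_trans (AECR_le_large_list (iL i) A4 hi)).
by rewrite lee_fin lerD2l.
Qed.
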